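(* Consider the NMPC scheme for the microgrid described in the context, with prediction horizon $M$, periodic reference solution $(x_{\mathrm{per}},u_{\mathrm{per}})(\cdot)$ of period $N_{\mathrm{per}}$, and NMPC subproblems $\mathcal P(x_0,d(\cdot\mid k))$. Assume control input realizability: the proposed control inputs resulting from the NMPC subproblem can be realized in the microgrid, i.e. $V_{check}(y(0\mid k),d(0\mid k))=0$, and applying them drives the system from the state $x(0\mid k)=x_0$ at time $t_k$ to the predicted state $x(1\mid k)=f(x_0,u(0\mid k))$ at time $t_{k+1}$. Suppose that the predicted demand remains unchanged, i.e. $d(i+1\mid k)=d(i\mid k+1)$ for $i=0,\dots,M-1$, and that the predicted demand of the problem at sampling time $t_{k+1}$ reaches the periodic reference demand at the end of the prediction horizon, i.e. $d(M\mid k+1)=d_{\mathrm{per}}(k+M+1)$. Then feasibility of the NMPC subproblem at sampling time $t_k$ implies feasibility of the NMPC subproblem at sampling time $t_{k+1}$: if $\mathcal P(x_0,d(\cdot\mid k))$ is feasible and $(x,\tilde z,u)(\cdot\mid k)$ is its solution, then $\mathcal P(x(1\mid k),d(\cdot\mid k+1))$ is feasible.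
   Context: **Microgrid.** Nodes $\mathcal N=\{1,\dots,N\}$; generator nodes $\mathcal G\subset\mathcal N$; battery nodes $\mathcal B\subset\mathcal N$; admittance matrix $Y=G+jB\in\mathbb C^{N\times N}$. Algebraic state $z=(p_l,q_l,v_l,\theta_l)_{l\in\mathcal N}\in\mathbb R^{4N}$ (active/reactive power, voltage magnitude, phase); $y=((p^g_l,q^g_l)_{l\in\mathcal G},(p^b_l,q^b_l)_{l\in\mathcal B})$ (generator and battery powers); demand $d=(p^d_l,q^d_l)_{l\in\mathcal N}\in\mathbb R^{2N}$. Power balance $g_{bal}(y,z,d)=0$ means $p_l=p^g_l+p^b_l-p^d_l$ and $q_l=q^g_l+q^b_l-q^d_l$ for all $l\in\mathcal N$ (powers of absent components are $0$). **AC power flow.** With $\theta_{lm}=\theta_l-\theta_m$, $p_{lm}=v_lv_m(G_{lm}\cos\theta_{lm}+B_{lm}\sin\theta_{lm})$, $q_{lm}=v_lv_m(G_{lm}\sin\theta_{lm}-B_{lm}\cos\theta_{lm})$, the set $\mathcal{AC}$ consists of all $z$ with $p_l=\sum_{m\in\mathcal N}p_{lm}$, $q_l=\sum_{m\in\mathcal N}q_{lm}$ for all $l$. $Y^{ac}(d)=\{y:\exists z\in\mathcal{AC},\ g_{bal}(y,z,d)=0\}$. **QC relaxation.** Operational bounds $v_l\in[\underline v_l,\overline v_l]$, $\theta_l\in[\underline\theta_l,\overline\theta_l]$ are given, with $|\theta_{ij}|\le\overline\theta_{ij}$. For $x\in[\underline x,\overline x]$, $y\in[\underline y,\overline y]$,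 the McCormick envelope of $xy$ is the set of values $w$ with $w\ge\underline xy+\underline yx-\underline x\underline y$, $w\ge\overline xy+\overline yx-\overline x\overline y$, $w\le\underline xy+\overline yx-\underline x\overline y$, $w\le\overline xy+\underline yx-\overline x\underline y$. Auxiliary variables $z_{\mathrm{QC}}\in\mathbb R^{n_{\mathrm{QC}}}$ replace the nonlinear terms: $v_i^2$ by $w_{ii}$ with $v_i^2\le w_{ii}\le(\underline v_i+\overline v_i)v_i-\underline v_i\overline v_i$; $v_iv_j$ ($i<j$) by a variable in its McCormick envelope; $\sin\theta_{ij}$ by $s\theta_{ij}$ with $\cos(\overline\theta_{ij}/2)(\theta_{ij}+\overline\theta_{ij}/2)-\sin(\overline\theta_{ij}/2)\le s\theta_{ij}\le\cos(\overline\theta_{ij}/2)(\theta_{ij}-\overline\theta_{ij}/2)+\sin(\overline\theta_{ij}/2)$; $\cos\theta_{ij}$ by $c\theta_{ij}$ with $\cos\overline\theta_{ij}\le c\theta_{ij}\le1-\frac{1-\cos\overline\theta_{ij}}{\overline\theta_{ij}^2}\theta_{ij}^2$; the remaining products of these auxiliary variables by variables in McCormick envelopes (with fixed valid bounds); quantities for reversed lines $(j,i)$ are given by the natural (anti)symmetry. With $p_{ij},q_{ij}$ expressed linearly in these variables, one adds $p_{ij}^2+q_{ij}^2\le w_{ii}l_{ij}$, $l_{ij}=G_{ij}(p_{ij}+p_{ji})-B_{ij}(q_{ij}+q_{ji})$. All this together with $p_l=\sum_mp_{lm}$, $q_l=\sum_mq_{lm}$ is written $g_{\mathrm{QC}}(z,z_{\mathrm{QC}})\le0$.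 **Dynamics.** Equidistant times $t_0,t_1,\dots$ with step $\Delta t$. State $x=(y,G^{\mathrm{ind}},G^{\mathrm{count}},B^{\mathrm{SOC}})$ with, for each $l\in\mathcal G$, on/off mode $G^{\mathrm{ind}}_l\in\{0,1\}$ and counter $G^{\mathrm{count}}_l\in\mathbb Z$, and for each $l\in\mathcal B$ state of charge $B^{\mathrm{SOC}}_l\in\mathbb R$. Control $u=(\delta p^g,\delta q^g,\delta p^b,\delta q^b,G^{\mathrm{switch}})$ with $G^{\mathrm{switch}}_l\in\{0,1\}$, $l\in\mathcal G$. The dynamics $x(i+1)=f(x(i),u(i))$ are: - $p^b_l(i+1)=p^b_l(i)+\delta p^b_l(i)$, $q^b_l(i+1)=q^b_l(i)+\delta q^b_l(i)$, $p^g_l(i+1)=p^g_l(i)+\delta p^g_l(i)$, $q^g_l(i+1)=q^g_l(i)+\delta q^g_l(i)$; - $B^{\mathrm{SOC}}_l(i+1)=(1-\mathbf p^{\mathrm{loss}}_l\Delta t)B^{\mathrm{SOC}}_l(i)-\Delta t\,(p^b_l(i+1)+(1-\mathbf p^{\mathrm{eff}}_l)|p^b_l(i+1)|)$; - if $G^{\mathrm{switch}}_l(i)=0$: $G^{\mathrm{ind}}_l(i+1)=G^{\mathrm{ind}}_l(i)$, $G^{\mathrm{count}}_l(i+1)=G^{\mathrm{count}}_l(i)+1$; if $G^{\mathrm{switch}}_l(i)=1$: $G^{\mathrm{ind}}_l(i+1)=1-G^{\mathrm{ind}}_l(i)$, $G^{\mathrm{count}}_l(i+1)=0$. **Path constraints**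 $h(x(i),u(i))\le0$, for all $l\in\mathcal G$: - if $G^{\mathrm{ind}}_l(i)=0$ then $p^g_l(i)=q^g_l(i)=0$; if $G^{\mathrm{ind}}_l(i)=1$ then $\underline p^g_l\le p^g_l(i)\le\overline p^g_l$, $\underline q^g_l\le q^g_l(i)\le\overline q^g_l$; - ramping: $|\delta p^g_l(i)|\le\overline{\mathbf p}^{\mathrm{ramp}}_l\,\overline p^g_l\,\Delta t$, with $\overline{\mathbf p}^{\mathrm{ramp}}_l\in(0,1]$; - maximal up/down time: $G^{\mathrm{count}}_l(i)\le G^{\mathrm{ind}}_l(i)\mathbf T^{\mathrm{max,on}}_l+(1-G^{\mathrm{ind}}_l(i))\mathbf T^{\mathrm{max,off}}_l$ (limits may be $\infty$, $0\cdot\infty=0$); - minimal up/down time: $G^{\mathrm{switch}}_l(i)=1\Rightarrow G^{\mathrm{ind}}_l(i)\mathbf T^{\mathrm{min,on}}_l+(1-G^{\mathrm{ind}}_l(i))\mathbf T^{\mathrm{min,off}}_l\le G^{\mathrm{count}}_l(i)$. **Stage cost.** With index $i+1$ quantities expressed via $f$, and given nonnegative cost coefficients, $$\ell(x(i),u(i))=\sum_{l\in\mathcal G}\big(G^{\mathrm{ind}}_l(i+1)\mathbf p^{\mathrm{base}}_l\Delta t+p^g_l(i+1)\mathbf p^{\mathrm{fuel}}_l\Delta t+\mathbf p^{\mathrm{startup}}_l(1-G^{\mathrm{ind}}_l(i))G^{\mathrm{switch}}_l(i)\big)+\sum_{l\in\mathcal B}\big(|p^b_l(i+1)|\mathbf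 p^{\mathrm{tp}}_l\Delta t+B^{\mathrm{SOC}}_l(i+1)\mathbf p^{\mathrm{soc}}_l\Delta t\big).$$ **Periodic reference.** The reference demand $d_{\mathrm{per}}$ is $N_{\mathrm{per}}$-periodic, where $N_{\mathrm{per}}\Delta t=24\,$h. The reference $(x_{\mathrm{per}},\tilde z_{\mathrm{per}},u_{\mathrm{per}})$, $\tilde z=(z,z_{\mathrm{QC}})$, is a solution of: minimize $\sum_{i=0}^{N_{\mathrm{per}}}\ell(x(i),u(i))$ subject to $g_{\mathrm{QC}}(z(i),z_{\mathrm{QC}}(i))\le0$, $g_{bal}(y(i),z(i),d_{\mathrm{per}}(i))=0$, $h(x(i),u(i))\le0$ ($0\le i\le N_{\mathrm{per}}$), $x(i+1)=f(x(i),u(i))$ ($0\le i<N_{\mathrm{per}}$), the startup bound $\frac12\big(G^{\mathrm{ind}}_l(N_{\mathrm{per}})-G^{\mathrm{ind}}_l(0)+\sum_{j=0}^{N_{\mathrm{per}}-1}G^{\mathrm{switch}}_l(j)\big)\le\overline{\mathbf G}^{\mathrm{startup}}_l$ ($l\in\mathcal G$), and periodicity: $p^g_l,q^g_l,G^{\mathrm{ind}}_l$ ($l\in\mathcal G$) and $p^b_l,q^b_l,B^{\mathrm{SOC}}_l$ ($l\in\mathcal B$) agree at $i=0$ and $i=N_{\mathrm{per}}$, and $G^{\mathrm{count}}_l(0)\equiv G^{\mathrm{count}}_l(N_{\mathrm{per}})\bmod N_{\mathrm{per}}$. The reference is extended periodically to all times (indices modulo $N_{\mathrm{per}}$, counters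 evolving by $f$); this indefinite extension is taken to satisfy all the constraints. **Reference functions.** $T^{\mathrm{switch}}_l(j)=\min\{s\ge0:G^{\mathrm{switch}}_{l,\mathrm{per}}(j+s)=1\}$ (with $\min\emptyset=+\infty$). **NMPC subproblem** $\mathcal P(x_0,d(\cdot\mid k))$ at time $t_k$, horizon $M\in\mathbb N$. The notation $(i\mid k)$ denotes the prediction for time $t_{k+i}$ made at $t_k$. Minimize $\sum_{i=0}^{M-1}\ell(x(i\mid k),u(i\mid k))$ over $x(i\mid k),\tilde z(i\mid k)$ ($0\le i\le M$) and $u(i\mid k)$ ($0\le i\le M-1$) subject to: - $x(0\mid k)=x_0$; $x(i+1\mid k)=f(x(i\mid k),u(i\mid k))$ for $0\le i\le M-1$; - $g_{\mathrm{QC}}(z(i\mid k),z_{\mathrm{QC}}(i\mid k))\le0$, $g_{bal}(y(i\mid k),z(i\mid k),d(i\mid k))=0$ and $h(x(i\mid k),u(i\mid k))\le0$ for $0\le i\le M$ (for $i=M$ only the components of $h$ not involving the control); - terminal constraints: $p^g_l,q^g_l,G^{\mathrm{ind}}_l$ at $(M\mid k)$ equal $p^g_{l,\mathrm{per}},q^g_{l,\mathrm{per}},G^{\mathrm{ind}}_{l,\mathrm{per}}$ at $(M+k\bmod N_{\mathrm{per}})$ for all $l\in\mathcal G$, and $B^{\mathrm{SOC}}_l(M\mid k)=B^{\mathrm{SOC}}_{l,\mathrm{per}}(M+k\bmod N_{\mathrm{per}})$ for all $l\in\mathcal B$; - runtime extendability, for all $l\in\mathcal G$: $\mathbf T^{\mathrm{min,off}}_l\le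 G^{\mathrm{count}}_l(M\mid k)+T^{\mathrm{switch}}_l(M+k\bmod N_{\mathrm{per}})\le\mathbf T^{\mathrm{max,off}}_l$ if the next reference switch is an ''on'' switch (i.e. $G^{\mathrm{ind}}_{l,\mathrm{per}}(M+k\bmod N_{\mathrm{per}})=0$), and the same with $\mathbf T^{\mathrm{min,on}}_l,\mathbf T^{\mathrm{max,on}}_l$ if it is an ''off'' switch; - startup counter constraints: for all $i\in\{0,\dots,M-1\}$, $l\in\mathcal G$, $$\tfrac12\Big(\sum_{j=i}^{i+N_{\mathrm{per}}-1}G^{\mathrm{switch}}_l(j\mid k)-G^{\mathrm{ind}}_l(i\mid k)+G^{\mathrm{ind}}_l(i+N_{\mathrm{per}}\mid k)\Big)\le\overline{\mathbf G}^{\mathrm{startup}}_l,$$ where $G^{\mathrm{switch}}_l(j\mid k)$ for $j\ge M$ is replaced by $G^{\mathrm{switch}}_{l,\mathrm{per}}(j+k\bmod N_{\mathrm{per}})$ and, if $i+N_{\mathrm{per}}\geq M$, $G^{\mathrm{ind}}_l(i+N_{\mathrm{per}}\mid k)$ is replaced by $G^{\mathrm{ind}}_{l,\mathrm{per}}(i+k\bmod N_{\mathrm{per}})$. **NMPC scheme.** At each $t_k$ the subproblem with $x_0$ equal to the current (exactly known) state is solved and $u(0\mid k)$ is applied. **Power flow deviation.** $V_{check}(y_{ref},d)$ is the minimal value of $\sum_{l\in\mathcal G}\|p^g_{l,ref}-p^g_l\|^2+\sum_{l\in\mathcal B}\|p^b_{l,ref}-p^b_l\|^2$ over $y\in Y^{ac}(d)$.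 *)

(* Defs.v *)
From HB Require Import structures.
From mathcomp Require Import all_boot all_order all_algebra.
From mathcomp Require Import all_classical all_reals all_analysis.
From mathcomp Require complex.

Set Implicit Arguments.
Unset Strict Implicit.
Unset Printing Implicit Defensive.

Import Order.TTheory GRing.Theory Num.Theory.

Local Open Scope ring_scope.

Record microgrid (R : realType) (N : nat) := Microgrid {
  Yadm : 'M[complex.complex R]_N;
  gens : {set 'I_N};
  bats : {set 'I_N};
  (* thbar i j bounds |theta_i - theta_j| for i < j *)
  vlo : 'I_N -> R;  vhi : 'I_N -> R;
  thlo : 'I_N -> R; thhi : 'I_N -> R;
  thbar : 'I_N -> 'I_N -> R;
  (* fixed bounds (i < j) on v_i v_j, sin theta_ij and cos theta_ij, used in the
     McCormick envelopes of the products of the auxiliary variables *)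
  vvlo : 'I_N -> 'I_N -> R; vvhi : 'I_N -> 'I_N -> R;
  slo : 'I_N -> 'I_N -> R;  shi : 'I_N -> 'I_N -> R;
  clo : 'I_N -> 'I_N -> R;  chi : 'I_N -> 'I_N -> R;
  (* in hours *)
  dt : R;
  Nper : nat;
  pglo : {l : 'I_N | l \in gens} -> R;  pghi : {l : 'I_N | l \in gens} -> R;
  qglo : {l : 'I_N | l \in gens} -> R;  qghi : {l : 'I_N | l \in gens} -> R;
  ramp : {l : 'I_N | l \in gens} -> R;
  (* run time limits, counted in time steps; +oo means "no limit" *)
  Tmin_on : {l : 'I_N | l \in gens} -> \bar R;
  Tmin_off : {l : 'I_N | l \in gens} -> \bar R;
  Tmax_on : {l : 'I_N | l \in gens} -> \bar R;
  Tmax_off : {l : 'I_N | l \in gens} -> \bar R;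
  max_startup : {l : 'I_N | l \in gens} -> R;
  ploss : {l : 'I_N | l \in bats} -> R;
  peff : {l : 'I_N | l \in bats} -> R;
  cbase : {l : 'I_N | l \in gens} -> R;
  cfuel : {l : 'I_N | l \in gens} -> R;
  cstartup : {l : 'I_N | l \in gens} -> R;
  ctp : {l : 'I_N | l \in bats} -> R;
  csoc : {l : 'I_N | l \in bats} -> R
}.

Definition gen (R : realType) (N : nat) (P : microgrid R N) : finType :=
  {l : 'I_N | l \in gens P}.

Definition bat (R : realType) (N : nat) (P : microgrid R N) : finType :=
  {l : 'I_N | l \in bats P}.

(* The McCormick bounds are valid for the nonlinear terms they stand for. *)
Definition valid_bounds (R : realType) (N : nat) (P : microgrid R N) : Prop :=
  forall v th : 'I_N -> R,
    (forall l, vlo P l <= v l <= vhi P l) ->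
    (forall l, thlo P l <= th l <= thhi P l) ->
    (forall i j : 'I_N, (i < j)%N -> `|th i - th j| <= thbar P i j) ->
    forall i j : 'I_N, (i < j)%N ->
      [/\ vvlo P i j <= v i * v j <= vvhi P i j,
          slo P i j <= sin (th i - th j) <= shi P i j &
          clo P i j <= cos (th i - th j) <= chi P i j].

Record microgrid_wf (R : realType) (N : nat) (P : microgrid R N) : Prop :=
  MicrogridWf {
  wf_bounds : valid_bounds P;
  wf_dt : 0 < dt P;
  wf_day : (Nper P)%:R * dt P = 24%:R;
  wf_ramp : forall l : gen P, 0 < ramp l <= 1;
  wf_gen_costs : forall l : gen P,
    [/\ 0 <= cbase l, 0 <= cfuel l & 0 <= cstartup l];
  wf_bat_costs : forall l : bat P, 0 <= ctp l /\ 0 <= csoc l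
}.

Record algebraic (R : realType) (N : nat) := Algebraic {
  z_p : 'I_N -> R; z_q : 'I_N -> R; z_v : 'I_N -> R; z_th : 'I_N -> R
}.

Record powers (R : realType) (N : nat) (P : microgrid R N) := Powers {
  pg : gen P -> R; qg : gen P -> R;
  pb : bat P -> R; qb : bat P -> R
}.

Record demand (R : realType) (N : nat) := Demand {
  pd : 'I_N -> R; qd : 'I_N -> R
}.

(* Extension by 0 to the nodes where the component is absent. *)
Definition at_node (R : realType) (N : nat) (A : {set 'I_N})
    (a : {l : 'I_N | l \in A} -> R) (l : 'I_N) : R :=
  oapp a 0 (insub l).

Definition g_bal (R : realType) (N : nat) (P : microgrid R N)
    (y : powers P) (z : algebraic R N) (d : demand R N) : Prop :=
  forall l : 'I_N,
    z_p z l = at_node (pg y) l + at_node (pb y) l - pd d l /\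
    z_q z l = at_node (qg y) l + at_node (qb y) l - qd d l.

Definition conductance (R : realType) (N : nat) (P : microgrid R N)
    (l m : 'I_N) : R := complex.Re (Yadm P l m).

Definition susceptance (R : realType) (N : nat) (P : microgrid R N)
    (l m : 'I_N) : R := complex.Im (Yadm P l m).

Definition p_ac (R : realType) (N : nat) (P : microgrid R N)
    (z : algebraic R N) (l m : 'I_N) : R :=
  let th := z_th z l - z_th z m in
  z_v z l * z_v z m * (conductance P l m * cos th + susceptance P l m * sin th).

Definition q_ac (R : realType) (N : nat) (P : microgrid R N)
    (z : algebraic R N) (l m : 'I_N) : R :=
  let th := z_th z l - z_th z m in
  z_v z l * z_v z m * (conductance P l m * sin th - susceptance P l m * cos th).

Definition AC_set (R : realType) (N : nat) (P : microgrid R N) :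
    set (algebraic R N) :=
  [set z | forall l : 'I_N,
    z_p z l = \sum_(m < N) p_ac P z l m /\ z_q z l = \sum_(m < N) q_ac P z l m]%classic.

Definition Y_ac (R : realType) (N : nat) (P : microgrid R N) (d : demand R N) :
    set (powers P) :=
  [set y | exists2 z, AC_set P z & g_bal y z d]%classic.

Definition power_deviation (R : realType) (N : nat) (P : microgrid R N)
    (yref y : powers P) : R :=
  \sum_(l : gen P) `|pg yref l - pg y l| ^+ 2 +
  \sum_(l : bat P) `|pb yref l - pb y l| ^+ 2.

(* [V_check yref d v]: the minimum is attained and equals v. *)
Definition V_check (R : realType) (N : nat) (P : microgrid R N)
    (yref : powers P) (d : demand R N) (v : R) : Prop :=
  let S := [set power_deviation yref y | y in Y_ac d]%classic in
  S v /\ lbound S v.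

Definition mccormick (R : realType) (xl xu yl yu x y w : R) : Prop :=
  [/\ xl * y + yl * x - xl * yl <= w,
      xu * y + yu * x - xu * yu <= w,
      w <= xl * y + yu * x - xl * yu &
      w <= xu * y + yl * x - xu * yl].

(* For the pair variables other than qc_l only the entries with i < j are
   meaningful; qc_vc and qc_vs stand for the products qc_vv * qc_c and
   qc_vv * qc_s. *)
Record qc_aux (R : realType) (N : nat) := QcAux {
  qc_w : 'I_N -> R;
  qc_vv : 'I_N -> 'I_N -> R;
  qc_s : 'I_N -> 'I_N -> R;
  qc_c : 'I_N -> 'I_N -> R;
  qc_vc : 'I_N -> 'I_N -> R;
  qc_vs : 'I_N -> 'I_N -> R;
  qc_l : 'I_N -> 'I_N -> R
}.

Definition sym_ext (R : realType) (N : nat) (a : 'I_N -> 'I_N -> R)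
    (i j : 'I_N) : R := if (i < j)%N then a i j else a j i.

Definition antisym_ext (R : realType) (N : nat) (a : 'I_N -> 'I_N -> R)
    (i j : 'I_N) : R := if (i < j)%N then a i j else - a j i.

(* On the diagonal theta_ii = 0, so that p_ii = G_ii v_i^2, q_ii = -B_ii v_i^2. *)
Definition p_qc (R : realType) (N : nat) (P : microgrid R N) (a : qc_aux R N)
    (i j : 'I_N) : R :=
  if i == j then conductance P i i * qc_w a i
  else conductance P i j * sym_ext (qc_vc a) i j
       + susceptance P i j * antisym_ext (qc_vs a) i j.

Definition q_qc (R : realType) (N : nat) (P : microgrid R N) (a : qc_aux R N)
    (i j : 'I_N) : R :=
  if i == j then - (susceptance P i i * qc_w a i)
  else conductance P i j * antisym_ext (qc_vs a) i j
       - susceptance P i j * sym_ext (qc_vc a) i j.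

Record g_QC (R : realType) (N : nat) (P : microgrid R N)
    (z : algebraic R N) (a : qc_aux R N) : Prop := GQC {
  gQC_v : forall l, vlo P l <= z_v z l <= vhi P l;
  gQC_th : forall l, thlo P l <= z_th z l <= thhi P l;
  gQC_thbar : forall i j : 'I_N, (i < j)%N ->
    `|z_th z i - z_th z j| <= thbar P i j;
  gQC_w : forall i,
    z_v z i ^+ 2 <= qc_w a i <= (vlo P i + vhi P i) * z_v z i - vlo P i * vhi P i;
  gQC_vv : forall i j : 'I_N, (i < j)%N ->
    mccormick (vlo P i) (vhi P i) (vlo P j) (vhi P j)
      (z_v z i) (z_v z j) (qc_vv a i j);
  gQC_s : forall i j : 'I_N, (i < j)%N ->
    let th := z_th z i - z_th z j in
    let h := thbar P i j / 2%:R in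
    cos h * (th + h) - sin h <= qc_s a i j <= cos h * (th - h) + sin h;
  gQC_c : forall i j : 'I_N, (i < j)%N ->
    let th := z_th z i - z_th z j in
    cos (thbar P i j) <= qc_c a i j
      <= 1 - (1 - cos (thbar P i j)) / thbar P i j ^+ 2 * th ^+ 2;
  gQC_vc : forall i j : 'I_N, (i < j)%N ->
    mccormick (vvlo P i j) (vvhi P i j) (clo P i j) (chi P i j)
      (qc_vv a i j) (qc_c a i j) (qc_vc a i j);
  gQC_vs : forall i j : 'I_N, (i < j)%N ->
    mccormick (vvlo P i j) (vvhi P i j) (slo P i j) (shi P i j)
      (qc_vv a i j) (qc_s a i j) (qc_vs a i j);
  gQC_l : forall i j : 'I_N, i != j ->
    qc_l a i j = conductance P i j * (p_qc P a i j + p_qc P a j i)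
                 - susceptance P i j * (q_qc P a i j + q_qc P a j i);
  gQC_current : forall i j : 'I_N, i != j ->
    p_qc P a i j ^+ 2 + q_qc P a i j ^+ 2 <= qc_w a i * qc_l a i j;
  gQC_p : forall l, z_p z l = \sum_(m < N) p_qc P a l m;
  gQC_q : forall l, z_q z l = \sum_(m < N) q_qc P a l m
}.

Record state (R : realType) (N : nat) (P : microgrid R N) := State {
  y : powers P;
  ind : gen P -> bool;
  runcount : gen P -> int;
  soc : bat P -> R
}.

Record control (R : realType) (N : nat) (P : microgrid R N) := Control {
  dpg : gen P -> R; dqg : gen P -> R;
  dpb : bat P -> R; dqb : bat P -> R;
  switch : gen P -> bool
}.

Definition dyn (R : realType) (N : nat) (P : microgrid R N)
    (x : state P) (u : control P) : state P :=
  let y' := {| pg := fun l => pg (y x) l + dpg u l;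
               qg := fun l => qg (y x) l + dqg u l;
               pb := fun l => pb (y x) l + dpb u l;
               qb := fun l => qb (y x) l + dqb u l |} in
  {| y := y';
     ind := fun l => if switch u l then ~~ ind x l else ind x l;
     runcount := fun l => if switch u l then 0 else runcount x l + 1;
     soc := fun l => (1 - ploss l * dt P) * soc x l
                     - dt P * (pb y' l + (1 - peff l) * `|pb y' l|) |}.

(* b * Ton + (1 - b) * Toff, with 0 * +oo = 0 *)
Definition mode_limit (R : realType) (b : bool) (Ton Toff : \bar R) : \bar R :=
  ((b%:R)%:E * Ton + (1 - b%:R)%:E * Toff)%E.

Definition path_state (R : realType) (N : nat) (P : microgrid R N)
    (x : state P) : Prop :=
  forall l : gen P,
    [/\ ind x l = false -> pg (y x) l = 0 /\ qg (y x) l = 0,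
        ind x l = true ->
          pglo l <= pg (y x) l <= pghi l /\ qglo l <= qg (y x) l <= qghi l &
        (((runcount x l)%:~R : R)%:E
          <= mode_limit (ind x l) (Tmax_on l) (Tmax_off l))%E].

Definition path_control (R : realType) (N : nat) (P : microgrid R N)
    (x : state P) (u : control P) : Prop :=
  forall l : gen P,
    `|dpg u l| <= ramp l * pghi l * dt P /\
    (switch u l = true ->
      (mode_limit (ind x l) (Tmin_on l) (Tmin_off l)
        <= ((runcount x l)%:~R : R)%:E)%E).

Definition path_constr (R : realType) (N : nat) (P : microgrid R N)
    (x : state P) (u : control P) : Prop := path_state x /\ path_control x u.

Definition stage_cost (R : realType) (N : nat) (P : microgrid R N)
    (x : state P) (u : control P) : R :=
  let x' := dyn x u in
  \sum_(l : gen P) ((ind x' l)%:R * cbase l * dt P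
                    + pg (y x') l * cfuel l * dt P
                    + cstartup l * (1 - (ind x l)%:R) * (switch u l)%:R)
  + \sum_(l : bat P) (`|pb (y x') l| * ctp l * dt P + soc x' l * csoc l * dt P).

(* Trajectories are indexed by nat; each problem constrains, and each cost reads,
   only the indices on its own horizon. *)
Record trajectory (R : realType) (N : nat) (P : microgrid R N) := Trajectory {
  tx : nat -> state P;
  tz : nat -> algebraic R N;
  tqc : nat -> qc_aux R N;
  tu : nat -> control P
}.

Definition startup_bound (R : realType) (N : nat) (P : microgrid R N)
    (s : trajectory P) (i : nat) : Prop :=
  forall l : gen P,
    2%:R^-1 * ((ind (tx s (i + Nper P)) l)%:R - (ind (tx s i) l)%:R
               + \sum_(i <= j < i + Nper P) (switch (tu s j) l)%:R)
      <= max_startup l.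

Record per_constraints (R : realType) (N : nat) (P : microgrid R N)
    (dper : nat -> demand R N) (s : trajectory P) : Prop := PerConstraints {
  per_QC : forall i, (i <= Nper P)%N -> g_QC P (tz s i) (tqc s i);
  per_bal : forall i, (i <= Nper P)%N -> g_bal (y (tx s i)) (tz s i) (dper i);
  per_h : forall i, (i <= Nper P)%N -> path_constr (tx s i) (tu s i);
  per_dyn : forall i, (i < Nper P)%N -> tx s i.+1 = dyn (tx s i) (tu s i);
  per_startup : startup_bound s 0;
  per_gen : forall l : gen P,
    [/\ pg (y (tx s 0)) l = pg (y (tx s (Nper P))) l,
        qg (y (tx s 0)) l = qg (y (tx s (Nper P))) l &
        ind (tx s 0) l = ind (tx s (Nper P)) l];
  per_bat : forall l : bat P,
    [/\ pb (y (tx s 0)) l = pb (y (tx s (Nper P))) l,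
        qb (y (tx s 0)) l = qb (y (tx s (Nper P))) l &
        soc (tx s 0) l = soc (tx s (Nper P)) l];
  per_count : forall l : gen P,
    (runcount (tx s 0) l = runcount (tx s (Nper P)) l %[mod (Nper P)%:Z])%Z
}.

Definition per_cost (R : realType) (N : nat) (P : microgrid R N)
    (s : trajectory P) : R :=
  \sum_(0 <= i < (Nper P).+1) stage_cost (tx s i) (tu s i).

Definition per_solution (R : realType) (N : nat) (P : microgrid R N)
    (dper : nat -> demand R N) (s : trajectory P) : Prop :=
  per_constraints dper s /\
  forall s' : trajectory P, per_constraints dper s' -> per_cost s <= per_cost s'.

Fixpoint ext_count (R : realType) (N : nat) (P : microgrid R N)
    (s : trajectory P) (t : nat) (l : gen P) : int :=
  if t is t'.+1 then
    if switch (tu s (t' %% Nper P)) l then 0 else ext_count s t' l + 1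
  else runcount (tx s 0) l.

(* Indefinite extension of a solution: everything but the counters is read off
   modulo Nper, the counters keep evolving with the dynamics. *)
Definition per_ext (R : realType) (N : nat) (P : microgrid R N)
    (s : trajectory P) : trajectory P :=
  {| tx := fun t => {| y := y (tx s (t %% Nper P));
                       ind := ind (tx s (t %% Nper P));
                       runcount := ext_count s t;
                       soc := soc (tx s (t %% Nper P)) |};
     tz := fun t => tz s (t %% Nper P);
     tqc := fun t => tqc s (t %% Nper P);
     tu := fun t => tu s (t %% Nper P) |}.

Record ext_admissible (R : realType) (N : nat) (P : microgrid R N)
    (dper : nat -> demand R N) (e : trajectory P) : Prop := ExtAdmissible {
  ext_QC : forall t, g_QC P (tz e t) (tqc e t);
  ext_bal : forall t, g_bal (y (tx e t)) (tz e t) (dper t);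
  ext_h : forall t, path_constr (tx e t) (tu e t);
  ext_dyn : forall t, tx e t.+1 = dyn (tx e t) (tu e t);
  ext_startup : forall t, startup_bound e t
}.

(* [per] is the extended reference generated by some solution of the periodic
   problem. *)
Definition is_reference (R : realType) (N : nat) (P : microgrid R N)
    (dper : nat -> demand R N) (per : trajectory P) : Prop :=
  [/\ forall i, dper (i + Nper P)%N = dper i,
      exists2 s, per_solution dper s & per = per_ext s &
      ext_admissible dper per].

Definition T_switch (R : realType) (N : nat) (P : microgrid R N)
    (per : trajectory P) (l : gen P) (j : nat) : \bar R :=
  match pselect (exists s, switch (tu per (j + s)) l) with
  | left ex => ((ex_minn ex)%:R)%:E
  | right _ => +oo%E
  end.

(* Predicted switches, continued by those of the reference for j >= M. *)
Definition pred_switch (R : realType) (N : nat) (P : microgrid R N)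
    (per : trajectory P) (M k : nat) (s : trajectory P) (l : gen P) (j : nat) :
    bool :=
  if (j < M)%N then switch (tu s j) l
  else switch (tu per ((j + k) %% Nper P)) l.

Definition pred_ind_after_period (R : realType) (N : nat) (P : microgrid R N)
    (per : trajectory P) (M k : nat) (s : trajectory P) (l : gen P) (i : nat) :
    bool :=
  if (M <= i + Nper P)%N then ind (tx per ((i + k) %% Nper P)) l
  else ind (tx s (i + Nper P)) l.

Record nmpc_constraints (R : realType) (N : nat) (P : microgrid R N)
    (per : trajectory P) (M k : nat) (x0 : state P) (d : nat -> demand R N)
    (s : trajectory P) : Prop := NmpcConstraints {
  nmpc_init : tx s 0 = x0;
  nmpc_dyn : forall i, (i < M)%N -> tx s i.+1 = dyn (tx s i) (tu s i);
  nmpc_QC : forall i, (i <= M)%N -> g_QC P (tz s i) (tqc s i);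
  nmpc_bal : forall i, (i <= M)%N -> g_bal (y (tx s i)) (tz s i) (d i);
  nmpc_h : forall i, (i < M)%N -> path_constr (tx s i) (tu s i);
  nmpc_h_end : path_state (tx s M);
  nmpc_end_gen : forall l : gen P,
    let r := tx per ((M + k) %% Nper P) in
    [/\ pg (y (tx s M)) l = pg (y r) l,
        qg (y (tx s M)) l = qg (y r) l &
        ind (tx s M) l = ind r l];
  nmpc_end_bat : forall l : bat P,
    soc (tx s M) l = soc (tx per ((M + k) %% Nper P)) l;
  nmpc_runtime : forall l : gen P,
    let j := ((M + k) %% Nper P)%N in
    let T := (((runcount (tx s M) l)%:~R : R)%:E + T_switch per l j)%E in
    if ind (tx per j) l
    then (Tmin_on l <= T <= Tmax_on l)%E
    else (Tmin_off l <= T <= Tmax_off l)%E;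
  nmpc_startup : forall (i : nat) (l : gen P), (i < M)%N ->
    2%:R^-1 * (\sum_(i <= j < i + Nper P) (pred_switch per M k s l j)%:R
               - (ind (tx s i) l)%:R
               + (pred_ind_after_period per M k s l i)%:R)
      <= max_startup l
}.

Definition nmpc_feasible (R : realType) (N : nat) (P : microgrid R N)
    (per : trajectory P) (M k : nat) (x0 : state P) (d : nat -> demand R N) :
    Prop :=
  exists s, nmpc_constraints per M k x0 d s.

Definition nmpc_cost (R : realType) (N : nat) (P : microgrid R N) (M : nat)
    (s : trajectory P) : R :=
  \sum_(0 <= i < M) stage_cost (tx s i) (tu s i).

Definition nmpc_solution (R : realType) (N : nat) (P : microgrid R N)
    (per : trajectory P) (M k : nat) (x0 : state P) (d : nat -> demand R N)
    (s : trajectory P) : Prop :=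
  nmpc_constraints per M k x0 d s /\
  forall s' : trajectory P,
    nmpc_constraints per M k x0 d s' -> nmpc_cost M s <= nmpc_cost M s'.

(* Control input realizability at t_k: [xcur] is the measured state of the plant
   at the sampling times, [s] the solution computed at t_k and [d0] the demand
   d(0|k). *)
Definition realizable (R : realType) (N : nat) (P : microgrid R N)
    (xcur : nat -> state P) (k : nat) (d0 : demand R N) (s : trajectory P) :
    Prop :=
  V_check (y (tx s 0)) d0 0 /\ xcur k.+1 = tx s 1.

(* Main.v *)
Require Import Defs.
From mathcomp Require Import all_boot all_order all_algebra.
From mathcomp Require Import all_classical all_reals all_analysis.

(** The new problem is solved by shifting the old solution by one step and
    appending one step along the periodic reference.

    The appended step starts from the old terminal state, which has the
    generator powers, generator modes and states of charge of the reference, but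
    possibly other battery powers and run time counters. Copying the reference
    generator increments and switches therefore keeps the generators on the
    reference; the battery increments are instead chosen so that the battery
    powers jump onto the reference values, which is allowed because they are
    not subject to ramping. The state of charge depends only on its old value
    and on the new battery powers, so it follows the reference as well
    ([joining_step]). Hence the new end point inherits the power flow and the
    power balance of the reference, whose demand is the predicted one there.

    Only the counters can differ from those of the reference, and the runtime
    extendability condition handles them. The predicted counter plus the time
    to the next reference switch is constant while no switch occurs, so the
    condition is carried along; at a switch the waiting time is 0 and the
    condition is exactly the minimal up/down time. After a switch the counter
    is 0 in both trajectories, and the condition says that the run of the
    reference that starts there has an admissible length; such a run ends
    because the reference is periodic ([reference_runtime_after_switch],
    [joining_runtime], [joining_path]).

    Every startup constraint of the new problem is the one of the old problem
    with window shifted by one, except for the last: its window lies on the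
    reference, which satisfies the bound on every period ([shifted_startup]). *)

Set Implicit Arguments.
Unset Strict Implicit.
Unset Printing Implicit Defensive.

Import Order.TTheory GRing.Theory Num.Theory.

Local Open Scope ring_scope.

(** * Preliminaries *)

Lemma mode_limitE (R : realType) (b : bool) (Ton Toff : \bar R) :
  mode_limit b Ton Toff = if b then Ton else Toff.
Proof.
by case: b; rewrite /mode_limit /= ?subrr ?subr0 mul1e mul0e ?adde0 ?add0e.
Qed.

Lemma sum_nat_shift (V : nmodType) (F : nat -> V) (a n m : nat) :
  \sum_(a + m <= j < a + m + n) F j = \sum_(a <= j < a + n) F (j + m)%N.
Proof.
by rewrite big_addn addnAC addnK.
Qed.

Lemma Nper_gt0 (R : realType) (N : nat) (P : microgrid R N) :
  microgrid_wf P -> (0 < Nper P)%N.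
Proof.
move=> /wf_day; case: (Nper P) => // /eqP.
by rewrite mul0r eq_sym pnatr_eq0.
Qed.

(** * Time to the next switch *)

Lemma T_switch_first (R : realType) (N : nat) (P : microgrid R N)
    (per : trajectory P) (l : gen P) (t n : nat) :
  switch (tu per (t + n)) l ->
  (forall m, (m < n)%N -> switch (tu per (t + m)) l = false) ->
  T_switch per l t = (n%:R)%:E.
Proof.
move=> sw_n no_sw; rewrite /T_switch.
case: pselect => [ex|[]]; last by exists n.
case: ex_minnP => m sw_m min_m.
suff -> : m = n by [].
apply/eqP; rewrite eqn_leq min_m //= leqNgt; apply/negP => lt_mn.
by rewrite no_sw in sw_m.
Qed.

Lemma T_switch_never (R : realType) (N : nat) (P : microgrid R N)
    (per : trajectory P) (l : gen P) (t : nat) :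
  (forall m, switch (tu per (t + m)) l = false) -> T_switch per l t = +oo%E.
Proof.
move=> no_sw; rewrite /T_switch; case: pselect => // ex.
by have [m] := ex; rewrite no_sw.
Qed.

Variant T_switch_spec (R : realType) (N : nat) (P : microgrid R N)
    (per : trajectory P) (l : gen P) (t : nat) : \bar R -> Prop :=
| TSwitchFirst n of switch (tu per (t + n)) l
    & (forall m, (m < n)%N -> switch (tu per (t + m)) l = false) :
    T_switch_spec per l t (n%:R)%:E
| TSwitchNever of (forall m, switch (tu per (t + m)) l = false) :
    T_switch_spec per l t +oo%E.

Lemma T_switchP (R : realType) (N : nat) (P : microgrid R N)
    (per : trajectory P) (l : gen P) (t : nat) :
  T_switch_spec per l t (T_switch per l t).
Proof.
case: (pselect (exists m, switch (tu per (t + m)) l)) => [ex|nex].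
  case: (ex_minnP ex) => n sw_n min_n.
  have no_sw m : (m < n)%N -> switch (tu per (t + m)) l = false.
    by apply: contra_ltnF => /min_n.
  by rewrite (T_switch_first sw_n no_sw); apply: TSwitchFirst.
have no_sw m : switch (tu per (t + m)) l = false.
  by apply: contra_notF nex => sw; exists m.
by rewrite T_switch_never //; apply: TSwitchNever.
Qed.

Lemma T_switch_ge0 (R : realType) (N : nat) (P : microgrid R N)
    (per : trajectory P) (l : gen P) (t : nat) : (0 <= T_switch per l t)%E.
Proof. by case: T_switchP => [n _ _|_]; rewrite ?lee_fin ?ler0n ?leey. Qed.

Lemma T_switch_now (R : realType) (N : nat) (P : microgrid R N)
    (per : trajectory P) (l : gen P) (t : nat) :
  switch (tu per t) l -> T_switch per l t = 0%E.
Proof. by move=> sw; rewrite (@T_switch_first _ _ _ _ _ t 0) ?addn0. Qed.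

Lemma T_switch_later (R : realType) (N : nat) (P : microgrid R N)
    (per : trajectory P) (l : gen P) (t : nat) :
  switch (tu per t) l = false ->
  T_switch per l t = (1 + T_switch per l t.+1)%E.
Proof.
move=> no_sw_t; case: (T_switchP per l t.+1) => [n sw_n no_sw|no_sw].
  rewrite (@T_switch_first _ _ _ _ _ t n.+1) ?addnS -?addSn //.
    by rewrite -natr1 addrC.
  by case=> [|m] lt_mn; rewrite ?addn0 // addnS -addSn no_sw.
rewrite T_switch_never //.
by case=> [|m]; rewrite ?addn0 // addnS -addSn no_sw.
Qed.

Lemma T_switch_ext (R : realType) (N : nat) (P : microgrid R N)
    (per : trajectory P) (l : gen P) (t t' : nat) :
  (forall m, tu per (t + m) = tu per (t' + m)) ->
  T_switch per l t = T_switch per l t'.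
Proof.
move=> eq_u; case: (T_switchP per l t') => [n sw_n no_sw|no_sw].
  by apply: T_switch_first => [|m lt_mn]; rewrite eq_u // no_sw.
by apply: T_switch_never => m; rewrite eq_u.
Qed.

(** * Runs of the periodic reference *)

Lemma run_until_switch (R : realType) (N : nat) (P : microgrid R N)
    (e : trajectory P) (l : gen P) (t n : nat) :
  (forall i, tx e i.+1 = dyn (tx e i) (tu e i)) ->
  (forall m, (m < n)%N -> switch (tu e (t + m)) l = false) ->
  ind (tx e (t + n)) l = ind (tx e t) l /\
  runcount (tx e (t + n)) l = runcount (tx e t) l + n%:Z.
Proof.
move=> e_dyn; elim: n => [|n IHn] no_sw; first by rewrite addn0 addr0.
have [|ind_n count_n] := IHn; first by move=> m /ltnW; exact: no_sw.
by rewrite addnS e_dyn /= no_sw // ind_n count_n intS [1 + _]addrC addrA.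
Qed.

(** Counters are excluded: they need not be periodic, since a unit that never
    switches keeps counting. *)
Lemma reference_mod (R : realType) (N : nat) (P : microgrid R N)
    (dper : nat -> demand R N) (per : trajectory P) (t : nat) :
  is_reference dper per ->
  [/\ tu per (t %% Nper P) = tu per t,
      y (tx per (t %% Nper P)) = y (tx per t),
      ind (tx per (t %% Nper P)) = ind (tx per t) &
      soc (tx per (t %% Nper P)) = soc (tx per t)].
Proof. by case=> _ [s _ ->] _; rewrite /= modn_mod. Qed.

Lemma reference_T_switch_mod (R : realType) (N : nat) (P : microgrid R N)
    (dper : nat -> demand R N) (per : trajectory P) (l : gen P) (t : nat) :
  is_reference dper per ->
  T_switch per l (t %% Nper P) = T_switch per l t.
Proof.
move=> ref; apply: T_switch_ext => m.
have [<- _ _ _] := reference_mod (t %% Nper P + m) ref.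
by have [<- _ _ _] := reference_mod (t + m) ref; rewrite modnDml.
Qed.

(** The runtime extendability condition for a counter value [c], stated at an
    absolute time instead of a time modulo the period, so that it can be moved
    from [t] to [t.+1] without wrapping around. *)
Definition runtime_ok (R : realType) (N : nat) (P : microgrid R N)
    (per : trajectory P) (l : gen P) (t : nat) (c : int) : Prop :=
  let T := (((c%:~R : R)%:E + T_switch per l t)%E : \bar R) in
  let b := ind (tx per t) l in
  (mode_limit b (Tmin_on l) (Tmin_off l) <= T
   <= mode_limit b (Tmax_on l) (Tmax_off l))%E.

Lemma reference_runtime_mod (R : realType) (N : nat) (P : microgrid R N)
    (dper : nat -> demand R N) (per : trajectory P) (l : gen P) (t : nat)
    (c : int) :
  is_reference dper per ->
  (let j := (t %% Nper P)%N in
   let T := ((c%:~R : R)%:E + T_switch per l j)%E in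
   if ind (tx per j) l
   then (Tmin_on l <= T <= Tmax_on l)%E
   else (Tmin_off l <= T <= Tmax_off l)%E) <-> runtime_ok per l t c.
Proof.
move=> ref /=; rewrite /runtime_ok !mode_limitE.
rewrite (reference_T_switch_mod l t ref).
by have [_ _ -> _] := reference_mod t ref; case: (ind _ _).
Qed.

(** The run starting after the switch has a counter equal to its age, so at its
    end the path constraints of the reference bound its length on both sides:
    the minimal time by the admissibility of the closing switch, the maximal
    time by the counter bound. *)
Lemma reference_runtime_after_switch (R : realType) (N : nat)
    (P : microgrid R N) (dper : nat -> demand R N) (per : trajectory P)
    (l : gen P) (t : nat) :
  (0 < Nper P)%N -> is_reference dper per ->
  switch (tu per t) l -> runtime_ok per l t.+1 0.
Proof.
move=> Nper_gt0 ref sw; have [_ _ adm] := ref.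
have count0 : runcount (tx per t.+1) l = 0 by rewrite (ext_dyn adm) /= sw.
rewrite /runtime_ok; case: T_switchP => [n sw_n no_sw|no_sw].
  have [ind_n count_n] := run_until_switch (ext_dyn adm) no_sw.
  have [st ct] := ext_h adm (t.+1 + n).
  have [_ _ le_max] := st l; have [_ min_le] := ct l.
  rewrite -ind_n add0e; move: le_max (min_le sw_n).
  by rewrite count_n count0 add0r => -> ->.
(* The switch at time t recurs one period later. *)
have := no_sw (Nper P).-1; rewrite addSnnS prednK //.
have [<- _ _ _] := reference_mod (t + Nper P) ref.
by rewrite modnDr; have [-> _ _ _] := reference_mod t ref; rewrite sw.
Qed.

(** * One step along the reference *)

(** Battery increments are not constrained, so they can correct any mismatch
    of the battery powers in a single step; generator increments are subject to
    ramping and are copied. *)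
Definition joining_control (R : realType) (N : nat) (P : microgrid R N)
    (per : trajectory P) (t : nat) (x : state P) : control P :=
  {| dpg := dpg (tu per t); dqg := dqg (tu per t);
     dpb := fun l => pb (y (tx per t.+1)) l - pb (y x) l;
     dqb := fun l => qb (y (tx per t.+1)) l - qb (y x) l;
     switch := switch (tu per t) |}.

(** What the terminal constraints prescribe: battery powers and counters are
    left free. *)
Definition on_reference (R : realType) (N : nat) (P : microgrid R N)
    (x r : state P) : Prop :=
  [/\ pg (y x) = pg (y r), qg (y x) = qg (y r), ind x = ind r & soc x = soc r].

(** The battery powers need not agree before the step, because the new state of
    charge is a function of the old one and of the new battery powers. *)
Lemma joining_step (R : realType) (N : nat) (P : microgrid R N)
    (per : trajectory P) (t : nat) (x : state P) :
  tx per t.+1 = dyn (tx per t) (tu per t) ->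
  on_reference x (tx per t) ->
  let x' := dyn x (joining_control per t x) in
  y x' = y (tx per t.+1) /\ on_reference x' (tx per t.+1).
Proof.
move=> per_dyn [eq_pg eq_qg eq_ind eq_soc] /=.
have cancel (T : Type) (a b : T -> R) : (fun l => a l + (b l - a l)) = b.
  by apply/funext => l; rewrite addrC subrK.
have cancel1 (a b : R) : a + (b - a) = b by rewrite addrC subrK.
have eq_y : y (dyn x (joining_control per t x)) = y (tx per t.+1).
  by rewrite /= !cancel per_dyn /= eq_pg eq_qg.
split=> //; split; rewrite ?eq_y //; first by rewrite per_dyn /= eq_ind.
by apply/funext => l; rewrite /= cancel1 per_dyn /= eq_soc.
Qed.

(** Without a switch, the counter grows by one and the waiting time shrinks by
    one. With a switch the counter is reset, and the length of the run of the
    reference that starts there decides. *)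
Lemma joining_runtime (R : realType) (N : nat) (P : microgrid R N)
    (dper : nat -> demand R N) (per : trajectory P) (t : nat) (x : state P)
    (l : gen P) :
  (0 < Nper P)%N -> is_reference dper per ->
  ind x = ind (tx per t) ->
  runtime_ok per l t (runcount x l) ->
  runtime_ok per l t.+1 (runcount (dyn x (joining_control per t x)) l).
Proof.
move=> Nper_gt0 ref eq_ind; have [_ _ adm] := ref.
rewrite /=; case: ifP => [sw _|no_sw].
  exact: reference_runtime_after_switch ref sw.
rewrite /runtime_ok (T_switch_later no_sw) (ext_dyn adm) /= no_sw.
by rewrite rmorphD /= EFinD addeA.
Qed.

(** The lower runtime bound yields the minimal up/down time when the reference
    switches at [t], since the waiting time is then 0; the upper bound yields
    the maximal up/down time when it does not, since the waiting time is then
    at least 1. When it does switch, the new counter is 0, as for the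
    reference. *)
Lemma joining_path (R : realType) (N : nat) (P : microgrid R N)
    (dper : nat -> demand R N) (per : trajectory P) (t : nat) (x : state P) :
  is_reference dper per ->
  on_reference x (tx per t) ->
  (forall l, runtime_ok per l t (runcount x l)) ->
  path_control x (joining_control per t x) /\
  path_state (dyn x (joining_control per t x)).
Proof.
move=> ref x_on run; have [_ _ adm] := ref.
have [_ _ eq_ind _] := x_on.
have [_ [eq_pg eq_qg eq_ind' _]] := joining_step (ext_dyn adm t) x_on.
split=> l.
  have [_ /(_ l)[ramp_l _]] := ext_h adm t; split=> //= sw.
  have := run l; rewrite /runtime_ok T_switch_now // adde0 -eq_ind.
  by case/andP.
have [/(_ l)[off_l on_l max_l] _] := ext_h adm t.+1.
split; rewrite ?eq_ind' ?eq_pg ?eq_qg //.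
have [sw|no_sw] := boolP (switch (tu per t) l).
  by move: max_l; rewrite {1}(ext_dyn adm) /= sw.
move/negbTE in no_sw; have := run l.
rewrite /runtime_ok (T_switch_later no_sw) /= no_sw => /andP[_].
rewrite (ext_dyn adm) /= no_sw; apply: le_trans.
by rewrite rmorphD /= EFinD addeA leeDl // T_switch_ge0.
Qed.

(** * The shifted solution *)

Definition shifted (R : realType) (N : nat) (P : microgrid R N)
    (per : trajectory P) (M k : nat) (s : trajectory P) : trajectory P :=
  let u := joining_control per (M + k) (tx s M) in
  {| tx := fun i => if (i < M)%N then tx s i.+1 else dyn (tx s M) u;
     tz := fun i => if (i < M)%N then tz s i.+1 else tz per (M + k).+1;
     tqc := fun i => if (i < M)%N then tqc s i.+1 else tqc per (M + k).+1;
     tu := fun i => if (i.+1 < M)%N then tu s i.+1 else u |}.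

(** The appended control switches as the reference does, which is also how the
    old problem continues its switches beyond the horizon. *)
Lemma shifted_pred_switch (R : realType) (N : nat) (P : microgrid R N)
    (dper : nat -> demand R N) (per : trajectory P) (M k : nat)
    (s : trajectory P) (l : gen P) (j : nat) :
  is_reference dper per ->
  pred_switch per M k.+1 (shifted per M k s) l j = pred_switch per M k s l j.+1.
Proof.
move=> ref; rewrite /pred_switch /= addnS -addSn.
case: (ltngtP j.+1 M) => // eq_jM.
by rewrite -eq_jM; have [-> _ _ _] := reference_mod (j.+1 + k) ref.
Qed.

Lemma terminal_on_reference (R : realType) (N : nat) (P : microgrid R N)
    (dper : nat -> demand R N) (per : trajectory P) (M k : nat)
    (x0 : state P) (d : nat -> demand R N) (s : trajectory P) :
  is_reference dper per -> nmpc_constraints per M k x0 d s ->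
  on_reference (tx s M) (tx per (M + k)).
Proof.
move=> ref cs; have [_ eq_y eq_ind eq_soc] := reference_mod (M + k) ref.
split; apply/funext => l; rewrite -?eq_y -?eq_ind -?eq_soc.
- by have [] := nmpc_end_gen cs l.
- by have [] := nmpc_end_gen cs l.
- by have [] := nmpc_end_gen cs l.
- exact: nmpc_end_bat cs l.
Qed.

Lemma shifted_startup (R : realType) (N : nat) (P : microgrid R N)
    (dper : nat -> demand R N) (per : trajectory P) (M k : nat)
    (x0 : state P) (d : nat -> demand R N) (s : trajectory P)
    (i : nat) (l : gen P) :
  (0 < Nper P)%N -> is_reference dper per ->
  nmpc_constraints per M k x0 d s -> (i < M)%N ->
  let s' := shifted per M k s in
  2%:R^-1 * (\sum_(i <= j < i + Nper P) (pred_switch per M k.+1 s' l j)%:R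
             - (ind (tx s' i) l)%:R
             + (pred_ind_after_period per M k.+1 s' l i)%:R)
    <= max_startup l.
Proof.
move=> Nper_gt0 ref cs lt_iM /=; have [_ _ adm] := ref.
have [_ _ ind_M _] := terminal_on_reference ref cs.
rewrite lt_iM.
under eq_bigr do rewrite (shifted_pred_switch _ _ _ _ _ ref) -addn1.
rewrite -(sum_nat_shift (fun j => (pred_switch per M k s l j)%:R)) addn1.
have [lt_i1M|le_Mi1] := ltnP i.+1 M.
  have := nmpc_startup cs l lt_i1M.
  suff -> : pred_ind_after_period per M k s l i.+1
          = pred_ind_after_period per M k.+1 (shifted per M k s) l i by [].
  rewrite /pred_ind_after_period /= !addSn addnS.
  case: leqP => [le|lt]; first by rewrite leqW.
  (* Within the horizon both sides are the predicted mode, unless the period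
     ends exactly at step M: there the terminal constraint identifies it with
     the reference mode. *)
  have [eq_M|neq] := eqVneq (i + Nper P).+1 M; last first.
    by rewrite leqNgt ltn_neqAle neq lt.
  rewrite eq_M leqnn ind_M.
  have [_ _ <- _] := reference_mod (M + k) ref.
  have -> : (M + k = (i + k).+1 + Nper P)%N by rewrite -eq_M !addSn addnAC.
  by rewrite modnDr.
(* The last window lies entirely on the reference. *)
have eq_iM : i.+1 = M by apply/eqP; rewrite eqn_leq lt_iM.
rewrite /pred_ind_after_period ifT; last first.
  by apply: leq_trans le_Mi1 _; rewrite -addn1 leq_add2l.
rewrite -addSnnS eq_iM ind_M.
have [_ _ -> _] := reference_mod (M + k) ref.
apply: le_trans (ext_startup adm (M + k) l).
have -> : ind (tx per (M + k + Nper P)) = ind (tx per (M + k)).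
  have [_ _ <- _] := reference_mod (M + k + Nper P) ref.
  by rewrite modnDr; have [_ _ -> _] := reference_mod (M + k) ref.
rewrite subrr add0r subrK sum_nat_shift.
rewrite (eq_big_nat _ _ (F2 := fun j => (switch (tu per (j + k)) l)%:R)) //.
move=> j /andP[le_Mj _]; rewrite /pred_switch ltnNge le_Mj /=.
by have [-> _ _ _] := reference_mod (j + k) ref.
Qed.

Lemma shifted_constraints (R : realType) (N : nat) (P : microgrid R N)
    (dper : nat -> demand R N) (per : trajectory P) (M k : nat)
    (x0 : state P) (d d' : nat -> demand R N) (s : trajectory P) :
  (0 < Nper P)%N -> is_reference dper per -> (0 < M)%N ->
  nmpc_constraints per M k x0 d s ->
  (forall i, (i < M)%N -> d i.+1 = d' i) -> d' M = dper (M + k).+1 ->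
  nmpc_constraints per M k.+1 (tx s 1) d' (shifted per M k s).
Proof.
move=> Nper_gt0 ref M_gt0 cs eq_d eq_dM; have [_ _ adm] := ref.
have x_on := terminal_on_reference ref cs.
have run l : runtime_ok per l (M + k) (runcount (tx s M) l).
  exact/(reference_runtime_mod _ _ _ ref)/(nmpc_runtime cs).
have [eq_y [eq_pg eq_qg eq_ind eq_soc]] := joining_step (ext_dyn adm _) x_on.
have [path_u path_x] := joining_path ref x_on run.
have [_ mod_y mod_ind mod_soc] := reference_mod (M + k).+1 ref.
split=> /=.
- by rewrite M_gt0.
- move=> i lt_iM; rewrite lt_iM; case: ltnP => [lt|ge].
    exact: nmpc_dyn cs _ lt.
  by have -> : i.+1 = M by apply/eqP; rewrite eqn_leq lt_iM.
- move=> i _; case: ltnP => [lt|_]; first exact: (nmpc_QC cs).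
  exact: ext_QC adm _.
- move=> i le_iM; case: ltnP => [lt|ge].
    by rewrite -eq_d //; apply: nmpc_bal cs _ lt.
  have -> : i = M by apply/eqP; rewrite eqn_leq le_iM.
  by rewrite eq_dM -/(dyn _ _) eq_y; apply: ext_bal adm _.
- move=> i lt_iM; rewrite lt_iM; case: ltnP => [lt|ge].
    exact: (nmpc_h cs).
  have -> : i.+1 = M by apply/eqP; rewrite eqn_leq lt_iM.
  by split; first exact: nmpc_h_end cs.
- by rewrite ltnn.
- by move=> l; rewrite ltnn addnS mod_y mod_ind eq_pg eq_qg eq_ind.
- by move=> l; rewrite ltnn addnS mod_soc eq_soc.
- move=> l; rewrite ltnn addnS; apply/(reference_runtime_mod _ _ _ ref).
  by apply: (joining_runtime Nper_gt0 ref) => //; case: x_on.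
- by move=> i l lt_iM; apply: (shifted_startup _ Nper_gt0 ref cs).
Qed.

Theorem proposition1 (R : realType) (N : nat) (P : microgrid R N)
    (dper : nat -> demand R N) (per : trajectory P)
    (M : nat) (d : nat -> nat -> demand R N) (xcur : nat -> state P)
    (k : nat) (s : trajectory P) :
  microgrid_wf P ->
  is_reference dper per ->
  (0 < M)%N ->
  nmpc_feasible per M k (xcur k) (d k) ->
  nmpc_solution per M k (xcur k) (d k) s ->
  realizable xcur k (d k 0%N) s ->
  (forall i, (i < M)%N -> d k i.+1 = d k.+1 i) ->
  d k.+1 M = dper (k + M + 1)%N ->
  nmpc_feasible per M k.+1 (tx s 1%N) (d k.+1) /\
  nmpc_feasible per M k.+1 (xcur k.+1) (d k.+1).
Proof.
move=> wf ref M_gt0 _ [cs _] [_ ->] eq_d.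
rewrite addn1 [(k + M)%N]addnC => eq_dM.
have cs' := shifted_constraints (Nper_gt0 wf) ref M_gt0 cs eq_d eq_dM.
by split; exists (shifted per M k s).
Qed.
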